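(* Optimal solutions to the follower's problem $$F_{nks}(\mathbf{y},\mathbf{z};\boldsymbol{\varepsilon_s})=\arg\max\Big[\sum_{m\in M_{nk}^0}U_{nks}^m(\mathbf{y};\varepsilon_{nks}^m)\,x_{nks}^m\;:\;\sum_{m\in M_{nk}^0}x_{nks}^m=1;\ x_{nks}^m\le z_{nk}^m\ \ (m\in M_{nk});\ x_{nks}^m\in\{0,1\}\ \ (m\in M_{nk}^0)\Big]$$ can be computed by solving a continuous relaxation $$\arg\max\Big[\big(U_{nks}^{m'}(\mathbf{y};\varepsilon_{nks}^{m'})-U_{nks}^{0}(\varepsilon_{nks}^0)\big)\,x_{nks}^{m'}\;:\;x_{nks}^{m'}\in[0,1]\Big].$$
   Context: A logistics provider (LP, the leader) makes offers to a set $N$ of shippers (followers). Each shipper $n\in N$ has a set $K_n$ of customer categories. $M_n$ is the set of service levels available for shipper $n$, and $M_{nk}$ is the set of service levels available for shipper $n$ and customers in category $k\in K_n$. The opt-out alternative is denoted $0$, and $M_{nk}^0=M_{nk}\cup\{0\}$. For each shipper $n$ and service level $m\in M_n$, $P_n^m$ is a finite set of price levels and $q_n^{mp}$ ($p\in P_n^m$) are the corresponding prices; no price is available for the opt-out, i.e. $P_n^0=\emptyset$. Leader variables: $y_n^{mp}\in\{0,1\}$ equals $1$ iff the LP offers price level $p$ and service level $m$ to shipper $n$; $z_{nk}^m\in\{0,1\}$ equals $1$ iff the LP assigns (offers) service level $m$ to shipper $n$ and category $k$. They satisfy the first-stage constraints: $\sum_{p\in P_n^m}y_n^{mp}\le 1$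 for $n\in N$, $m\in M_n$; $\sum_{m\in M_n}\sum_{p\in P_n^m}y_n^{mp}\le |K_n|$ for $n\in N$; $\sum_{m\in M_{nk}}z_{nk}^m\le 1$ for $n\in N$, $k\in K_n$; $z_{nk}^m\le\sum_{p\in P_n^m}y_n^{mp}$ for $n\in N$, $k\in K_n$, $m\in M_n$. Vectors $\mathbf{y}$ and $\mathbf{z}$ collect these variables. Follower variables: $x_{nks}^m\in\{0,1\}$ equals $1$ iff, in scenario $s$, shipper $n$ chooses alternative $m\in M_{nk}^0$ for category $k$. The follower's problem is stated for a given shipper $n\in N$, category $k\in K_n$ and scenario $s\in S$, and is solved for fixed leader decisions $\mathbf{y},\mathbf{z}$. Utilities: for $m\in M_{nk}$, $U_{nks}^m(\mathbf{y};\varepsilon_{nks}^m)=\alpha\big(\sum_{p\in P_n^m}q_n^{mp}y_n^{mp}\big)+L_{nk}^m+\varepsilon_{nks}^m$, and for the opt-out $U_{nks}^0(\varepsilon_{nks}^0)=L_{nk}^0+\varepsilon_{nks}^0$ (in the objective of the follower's problem, the term for $m=0$ uses this utility). Here $\alpha$ is the price sensitivity parameter and $L_{nk}^m$ is an exogenous quantity capturing the preference of the customers for the service level. Each noise term $\varepsilon_{nk}^m$ is a continuous random variable with support $\Xi$; $S$ is a set of scenarios drawn independently at random, $\boldsymbol{\varepsilon_s}$ is the realization in scenario $s$ of the vector $\boldsymbol{\varepsilon}$ of all noise terms, and $\varepsilon_{nks}^m$ is the realization of $\varepsilon_{nk}^m$ in scenario $s$. Meaning of $m'$: since at most one $z_{nk}^m$,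 $m\in M_{nk}$, equals $1$, either $z_{nk}^m=0$ for all $m\in M_{nk}$, and then $x_{nks}^m=0$ for all $m\in M_{nk}$, or there is one service level with $z_{nk}^{m'}=1$, and $m'$ denotes that level. The opt-out variable is recovered from $x_{nks}^0=1-\sum_{m\in M_{nk}}x_{nks}^m$. *)

(* Defs.v *)
From HB Require Import structures.
From mathcomp Require Import all_boot all_order all_algebra.
From mathcomp Require Import all_classical all_reals all_analysis.

Set Implicit Arguments.
Unset Strict Implicit.
Unset Printing Implicit Defensive.

Import Order.TTheory GRing.Theory Num.Theory.
Import numFieldNormedType.Exports.

Local Open Scope classical_set_scope.
Local Open Scope ring_scope.

Definition argmax (R : realType) (T : Type) (D : set T) (f : T -> R) : set T :=
  [set x | D x /\ forall x', D x' -> f x' <= f x].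

Definition binary (R : realType) : set R := [set t | t = 0 \/ t = 1].

(** The sets N, K_n, M_n and P_n^m are types; M_nk is a subset of M_n. *)
Record market (R : realType) := Market {
  shipper : finType;
  category : shipper -> finType;
  level : shipper -> finType;
  avail : forall n, category n -> {set level n};
  price_level : forall n, level n -> finType;
  price : forall n (m : level n), price_level m -> R }.

Arguments category {R} _ _.
Arguments level {R} _ _.
Arguments avail {R _ n} _.
Arguments price_level {R _ n} _.
Arguments price {R _ n m} _.

Section Market.
Variables (R : realType) (A : market R).

Definition service (n : shipper A) (k : category A n) : finType :=
  {m : level A n | m \in avail k}.

(** [M_nk^0]: [None] is the opt-out, which has no price by construction. *)
Definition alternative (n : shipper A) (k : category A n) : finType :=
  option (service k).

Definition price_decision :=
  forall (n : shipper A) (m : level A n), price_level m -> bool.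

Definition level_decision :=
  forall n : shipper A, category A n -> level A n -> bool.

(** One real number for each (n, k, m) with m in [M_nk^0]; used both for the
    preferences L and for the noise realized in a scenario. *)
Definition alternative_vector :=
  forall (n : shipper A) (k : category A n), alternative k -> R.

Definition first_stage (y : price_decision) (z : level_decision) : Prop :=
  [/\ forall n (m : level A n), (\sum_(p : price_level m) y n m p <= 1)%N,
      forall n, (\sum_(m : level A n) \sum_(p : price_level m) y n m p
                 <= #|category A n|)%N,
      forall n (k : category A n), (\sum_(m in avail k) z n k m <= 1)%N
    & forall n (k : category A n) (m : level A n),
        (z n k m <= \sum_(p : price_level m) y n m p)%N].

Definition utility (alpha : R) (L : alternative_vector) (y : price_decision)
    (e : alternative_vector) (n : shipper A) (k : category A n)
    (a : alternative k) : R :=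
  match a with
  | Some m => alpha * (\sum_(p : price_level (val m)) price p * (y n (val m) p)%:R)
              + L n k (Some m) + e n k (Some m)
  | None => L n k None + e n k None
  end.

Definition follower_objective (n : shipper A) (k : category A n)
    (U : alternative k -> R) (x : alternative k -> R) : R :=
  \sum_a U a * x a.

(** [D] is the range of each variable: {0, 1} for the follower's problem,
    [0, 1] for its linear relaxation. *)
Definition follower_feasible (D : set R) (z : level_decision)
    {n : shipper A} {k : category A n} : set (alternative k -> R) :=
  [set x | [/\ \sum_a x a = 1,
               forall m : service k, x (Some m) <= (z n k (val m))%:R
             & forall a, D (x a)]].

Definition follower (z : level_decision) (n : shipper A) (k : category A n)
    (U : alternative k -> R) : set (alternative k -> R) :=
  argmax (follower_feasible (@binary R) z) (follower_objective U).

Definition follower_linear_relaxation (z : level_decision) (n : shipper A)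
    (k : category A n) (U : alternative k -> R) : set (alternative k -> R) :=
  argmax (follower_feasible `[0, 1] z) (follower_objective U).

Definition reduced_relaxation (n : shipper A) (k : category A n)
    (U : alternative k -> R) (m' : service k) : set R :=
  argmax `[0, 1] (fun t : R => (U (Some m') - U None) * t).

Definition recover_optout (n : shipper A) (k : category A n)
    (x : service k -> R) (a : alternative k) : R :=
  match a with
  | Some m => x m
  | None => 1 - \sum_(m : service k) x m
  end.

Definition lift_offered (n : shipper A) (k : category A n) (m' : service k)
    (t : R) : alternative k -> R :=
  recover_optout (fun m => if m == m' then t else 0).

End Market.

Section Noise.
Context d (Omega : measurableType d) (R : realType) (P : probability Omega R).

Definition continuous_rv (X : {RV P >-> R}) : Prop := continuous (cdf X).

(** Topological support of the law of [X]. *)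
Definition rv_support (X : {RV P >-> R}) : set R :=
  [set r | forall e : R, 0 < e -> (0 < distribution P X (ball r e))%E].

End Noise.

(* Main.v *)
Require Import Defs.
From mathcomp Require Import all_boot all_order all_algebra.
From mathcomp Require Import all_classical all_reals all_analysis.

Set Implicit Arguments.
Unset Strict Implicit.
Unset Printing Implicit Defensive.

Import Order.TTheory GRing.Theory Num.Theory.
Import numFieldNormedType.Exports.

Local Open Scope classical_set_scope.
Local Open Scope ring_scope.

(** A feasible choice is a vector indexed by the alternatives
    whose entries sum to one, so the opt-out entry is a function of the others.
    The constraints [x^m <= z^m] force every level that is not offered to zero,
    and the first-stage constraints allow a single offered level [m'].  The
    feasible set is thus a copy of the range of the one variable [t = x^{m'}]:
    of {0, 1} for the follower's problem and of [0, 1] for its relaxation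
    (lemma [feasible_offered]).  Along this parametrization the objective is
    the affine function [U^0 + (U^{m'} - U^0) t], whose constant term does not
    affect the maximizers (lemma [argmax_feasible_offered]).

    What remains is about a linear function [c * t] on [0, 1].  It attains its
    maximum at an end of the interval, so the maximizers over {0, 1} are exactly
    the binary maximizers over [0, 1] (lemma [argmax_binary_linear]), and there
    is at least one.  If [c != 0], every maximizer is an end of the interval,
    and solving the relaxation solves the binary problem without any selection;
    if [c = 0], the shipper is indifferent and fractional [t] are optimal for
    the relaxation too.

    When no level is offered, opting out is the single feasible choice (lemma
    [feasible_no_offer]), hence the optimal one. *)

(** * Maximizers *)

Lemma argmax_image (R : realType) (T T' : Type) (g : T -> T') (D : set T)
    (f : T' -> R) :
  argmax (g @` D) f = g @` argmax D (f \o g).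
Proof.
apply/seteqP; split => [_ [[t Dt <-] fmax]|_ [t [Dt fmax] <-]].
- by exists t => //; split=> // t' Dt'; apply: fmax; exists t'.
- by split; [exists t|move=> _ [t' Dt' <-]; exact: fmax].
Qed.

Lemma argmax_addl (R : realType) (T : Type) (D : set T) (b : R) (f : T -> R) :
  argmax D (fun t => b + f t) = argmax D f.
Proof.
by apply/seteqP; split => t [Dt fmax]; split=> // t' /fmax; rewrite lerD2l.
Qed.

Lemma argmax_eq_value (R : realType) (T : Type) (D : set T) (f : T -> R)
    (t u : T) :
  argmax D f t -> argmax D f u -> f t = f u.
Proof.
by move=> [Dt tmax] [Du umax]; apply/eqP; rewrite eq_le umax // tmax.
Qed.

Lemma argmax_set1 (R : realType) (T : Type) (t : T) (f : T -> R) :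
  argmax [set t] f = [set t].
Proof.
by apply/seteqP; split => [_ []//|_ ->]; split=> // _ ->.
Qed.

(** * Linear functions on the unit interval *)

Section LinearOnUnitInterval.
Variables (R : realType) (c : R).

Lemma binary_subset_itv01 : @binary R `<=` `[0, 1].
Proof. by move=> _ [] ->; rewrite /= in_itv /= lexx ler01. Qed.

(** A value [c * t] on [0, 1] lies between the end values [0] and [c], so
    beating both ends is the same as beating the whole interval. *)
Lemma argmax_binary_linear :
  argmax (@binary R) (fun t => c * t)
    = argmax `[0, 1] (fun t => c * t) `&` @binary R.
Proof.
apply/seteqP; split => [t [bt tmax]|t [[_ tmax] bt]]; last first.
  by split=> // t' /binary_subset_itv01; exact: tmax.
split=> //; split=> [|t']; first exact: binary_subset_itv01.
rewrite /= in_itv /= => /andP[t'0 t'1].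
have ge0 : 0 <= c * t by rewrite -(mulr0 c); apply: tmax; left.
have gec : c <= c * t by rewrite -{1}(mulr1 c); apply: tmax; right.
have [c0|c0] := leP 0 c.
- by apply: le_trans gec; rewrite ler_piMr.
- by apply: le_trans ge0; rewrite mulr_le0_ge0 // ltW.
Qed.

Lemma argmax_binary_linear_nonempty :
  argmax (@binary R) (fun t => c * t) !=set0.
Proof.
have [c0|c0] := leP 0 c.
- by exists 1; split; [right|move=> _ [] ->; rewrite ?mulr0 mulr1].
- by exists 0; split; [left|move=> _ [] ->; rewrite ?mulr1 mulr0 // ltW].
Qed.

(** A linear function that is not constant is strictly monotone, so it has no
    maximizer inside the interval. *)
Lemma argmax_linear_binary :
  c != 0 -> argmax `[0, 1] (fun t => c * t) `<=` @binary R.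
Proof.
move=> c_neq0 t [] /=; rewrite in_itv /= => /andP[t0 t1] tmax.
have [c_gt0|c_lt0|c0] := ltgtP 0 c; last by rewrite -c0 eqxx in c_neq0.
- right; apply/eqP; rewrite eq_le t1 -(ler_pM2l c_gt0).
  by apply: tmax; rewrite /= in_itv /= lexx ler01.
- left; apply/eqP; rewrite eq_le t0 -(ler_nM2l c_lt0) andbT.
  by apply: tmax; rewrite /= in_itv /= lexx ler01.
Qed.

End LinearOnUnitInterval.

(** * Feasible choices as functions of the offered level *)

Section Follower.
Variables (R : realType) (A : market R) (n : shipper A) (k : category A n).
Variable z : level_decision A.

Lemma sum_alternative (F : alternative k -> R) :
  \sum_a F a = F None + \sum_(m : service k) F (Some m).
Proof.
rewrite (bigD1 None) //=; congr (_ + _).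
rewrite (reindex_omap Some id) /=; last by case.
by apply: eq_bigl => m; rewrite eqxx.
Qed.

Lemma recover_optout_sum1 (x : alternative k -> R) :
  \sum_a x a = 1 -> recover_optout (x \o Some) = x.
Proof.
rewrite sum_alternative => sum1; apply/funext; case=> //=.
by rewrite -sum1 addrK.
Qed.

Lemma sum_recover_optout (x : service k -> R) :
  \sum_a recover_optout x a = 1.
Proof. by rewrite sum_alternative /= subrK. Qed.

Lemma lift_offered_optout (m' : service k) (t : R) :
  lift_offered m' t None = 1 - t.
Proof. by rewrite /lift_offered /= -big_mkcond big_pred1_eq. Qed.

Lemma objective_lift_offered (U : alternative k -> R) (m' : service k) (t : R) :
  follower_objective U (lift_offered m' t)
    = U None + (U (Some m') - U None) * t.
Proof.
rewrite /follower_objective sum_alternative lift_offered_optout.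
rewrite (bigD1 m') //= eqxx big1 => [|m /negPf ->]; last by rewrite mulr0.
by rewrite addr0 mulrBr mulr1 mulrBl addrA addrAC.
Qed.

Lemma first_stage_offered_unique (y : price_decision A) (m' : service k) :
  first_stage y z -> z k (val m') ->
  forall m : service k, m != m' -> z k (val m) = false.
Proof.
move=> [_ _ + _] zm' m m_neq => /(_ n k).
rewrite (bigD1 (val m')) ?(valP m') //= zm'.
rewrite (bigD1 (val m)) /=; last by rewrite (valP m) val_eqE.
by case: (z k (val m)).
Qed.

Lemma not_offered_eq0 (D : set R) (x : alternative k -> R) (m : service k) :
  D `<=` `[0, 1] -> follower_feasible D z x -> z k (val m) = false ->
  x (Some m) = 0.
Proof.
move=> D01 [_ xz xD] zm; apply/eqP; rewrite eq_le.
have := xz m; rewrite zm => -> /=.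
by have /= := D01 _ (xD (Some m)); rewrite in_itv /= => /andP[].
Qed.

Lemma feasible_no_offer (D : set R) :
  D `<=` `[0, 1] -> D 0 -> D 1 ->
  (forall m : service k, z k (val m) = false) ->
  follower_feasible D z = [set recover_optout (fun _ : service k => 0)].
Proof.
move=> D01 D0 D1 z0; apply/seteqP; split => [x xF|_ ->].
- have [sum1 _ _] := xF; rewrite /= -(recover_optout_sum1 sum1).
  congr recover_optout; apply/funext => m /=.
  exact: not_offered_eq0 D01 xF (z0 m).
- split=> [|m|[m|]] //=; first exact: sum_recover_optout.
  by rewrite big1 // subr0.
Qed.

(** The range [D] is kept abstract so that {0, 1} and [0, 1] are treated at
    once: both contain 0, the value of a level that is not offered, and are
    stable under [t |-> 1 - t], which yields the opt-out entry. *)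
Lemma feasible_offered (D : set R) (m' : service k) :
  D `<=` `[0, 1] -> D 0 -> (forall t, D t -> D (1 - t)) ->
  z k (val m') -> (forall m : service k, m != m' -> z k (val m) = false) ->
  follower_feasible D z = lift_offered m' @` D.
Proof.
move=> D01 D0 DC zm' zother; apply/seteqP; split => [x xF|_ [t Dt <-]].
- have [sum1 _ xD] := xF; exists (x (Some m')); first exact: xD.
  rewrite -[RHS](recover_optout_sum1 sum1) /lift_offered.
  congr recover_optout; apply/funext => m /=.
  by have [->//|/zother zm] := eqVneq; rewrite (not_offered_eq0 D01 xF zm).
- split=> [|m|[m|]]; first exact: sum_recover_optout.
  + rewrite /=; have [->|_] := eqVneq; last by rewrite ler0n.
    by rewrite zm'; have /= := D01 _ Dt; rewrite in_itv /= => /andP[].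
  + by rewrite /=; case: eqP.
  + by rewrite lift_offered_optout; exact: DC.
Qed.

Lemma argmax_feasible_offered (D : set R) (m' : service k)
    (U : alternative k -> R) :
  D `<=` `[0, 1] -> D 0 -> (forall t, D t -> D (1 - t)) ->
  z k (val m') -> (forall m : service k, m != m' -> z k (val m) = false) ->
  argmax (follower_feasible D z) (follower_objective U)
    = lift_offered m' @` argmax D (fun t => (U (Some m') - U None) * t).
Proof.
move=> D01 D0 DC zm' zother.
have objE : follower_objective U \o lift_offered m'
    = fun t => U None + (U (Some m') - U None) * t.
  by apply/funext => t; exact: objective_lift_offered.
by rewrite (feasible_offered D01 D0 DC zm' zother) argmax_image objE argmax_addl.
Qed.

End Follower.

Theorem proposition1 (R : realType) (A : market R)
    (alpha : R) (L : alternative_vector A)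
    (d : measure_display) (Omega : measurableType d) (P : probability Omega R)
    (eps : forall (n : shipper A) (k : category A n),
       alternative k -> {RV P >-> R})
    (Xi : set R)
    (eps_continuous : forall (n : shipper A) (k : category A n)
       (a : alternative k), continuous_rv (eps n k a))
    (eps_support : forall (n : shipper A) (k : category A n)
       (a : alternative k), rv_support (eps n k a) = Xi)
    (S : finType) (draw : S -> Omega)
    (y : price_decision A) (z : level_decision A) (yz : first_stage y z)
    (n : shipper A) (k : category A n) (s : S) :
  let eps_s : alternative_vector A := fun n k a => eps n k a (draw s) in
  let U : alternative k -> R := @utility R A alpha L y eps_s n k in
  ((forall m : service k, z n k (val m) = false) ->
     follower z U = [set recover_optout (fun _ : service k => 0)])
  /\
  (forall m' : service k, z n k (val m') = true ->
     [/\ follower_linear_relaxation z U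
           = lift_offered m' @` reduced_relaxation U m',
         follower z U
           = lift_offered m' @` (reduced_relaxation U m' `&` @binary R),
         reduced_relaxation U m' `&` @binary R !=set0,
         (forall t x, reduced_relaxation U m' t -> follower z U x ->
            follower_objective U (lift_offered m' t) = follower_objective U x)
       & U (Some m') != U None ->
           follower z U = lift_offered m' @` reduced_relaxation U m']).
Proof.
move=> eps_s U; split => [z0|m' zm'].
  rewrite /follower feasible_no_offer ?argmax_set1 //.
  - exact: binary_subset_itv01.
  - by left.
  - by right.
have zother := first_stage_offered_unique yz zm'.
have relaxE : follower_linear_relaxation z U
    = lift_offered m' @` reduced_relaxation U m'.
  apply: argmax_feasible_offered => //=; first by rewrite in_itv /= lexx ler01.
  by move=> t; rewrite !in_itv /= => /andP[t0 t1]; rewrite subr_ge0 t1 gerBl.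
have followE : follower z U
    = lift_offered m' @` (reduced_relaxation U m' `&` @binary R).
  rewrite /reduced_relaxation -argmax_binary_linear.
  apply: argmax_feasible_offered => //; first exact: binary_subset_itv01.
  - by left.
  - by move=> _ [] ->; [right; rewrite subr0|left; rewrite subrr].
split=> //.
- rewrite /reduced_relaxation -argmax_binary_linear.
  exact: argmax_binary_linear_nonempty.
- move=> t x tmax; rewrite followE => -[u [umax _] <-].
  rewrite !objective_lift_offered; congr (_ + _).
  exact: argmax_eq_value tmax umax.
- move=> U_neq; rewrite followE; congr (_ @` _); apply/setIidPl.
  by apply: argmax_linear_binary; rewrite subr_eq0.
Qed.
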